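(* Let $v=\sum_k\alpha_kv^k$ be the collective Llull matrix on a finite set $A$ of finitely many individual votes $v^k$ (Llull matrices on $A$) with weights $\alpha_k\ge0$, $\sum_k\alpha_k=1$. Let $C\subseteq A$ be a nonempty cluster for all of the individual votes $v^k$ (hence for $v$). Let $\tilde A=(A\setminus C)\cup\{\tilde c\}$, where $\tilde c$ is a new element, and let $\tilde v$ be the Llull matrix on $\tilde A$ given by $\tilde v_{pq}=v_{pq}$, $\tilde v_{p\tilde c}=v_{pc}$, $\tilde v_{\tilde cq}=v_{cq}$ for $p,q\in A\setminus C$ with $p\ne q$ in the first equality, where $c$ is an arbitrary element of $C$. Let $r_x$ ($x\in A$) and $\tilde r_x$ ($x\in\tilde A$) be the rank-like rates determined by $v$ and $\tilde v$ respectively. Then the ranking $\tilde\sigma=\{xy: x,y\in\tilde A,\ x\neq y,\ \tilde r_x<\tilde r_y\}$ coincides with the contraction by the cluster $C$ of the ranking $\sigma=\{xy: x,y\in A,\ x\ne y,\ r_x<r_y\}$.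
   Context: Let $A$ be a finite set with $N\ge1$ elements and $\Pi$ the set of ordered pairs $xy$ with $x,y\in A$, $x\ne y$. A relation on $A$ is a subset of $\Pi$. A Llull matrix on $A$ is a family $v=(v_{xy})_{xy\in\Pi}$ with $v_{xy}\in[0,1]$ and $v_{xy}+v_{yx}\le1$. Turnovers: $t_{xy}=v_{xy}+v_{yx}$. Clusters: $C\subseteq A$ is a cluster for a system of binary scores $(v_{xy})$ when $v_{ax}=v_{bx}$ and $v_{xa}=v_{xb}$ whenever $a,b\in C$ and $x\notin C$. $C$ is a cluster for a relation $\rho\subseteq\Pi$ when, for any $x\notin C$, having $ax\in\rho$ for some $a\in C$ implies $bx\in\rho$ for all $b\in C$, and having $xa\in\rho$ for some $a\in C$ implies $xb\in\rho$ for all $b\in C$. Under the hypothesis of the claim, $C$ is a cluster for the relation $\sigma$. Contraction of a relation $\rho$ by a cluster $C$: the relation $\tilde\rho$ on $\tilde A=(A\setminus C)\cup\{\tilde c\}$ such that, for $x,y\in A\setminus C$: $x\tilde c\in\tilde\rho$ iff there is $c\in C$ with $xc\in\rho$; $\tilde cy\in\tilde\rho$ iff there is $c\in C$ with $cy\in\rho$; and $xy\in\tilde\rho$ iff $xy\in\rho$. Indirect scores: $v^*_{xy}=\max\min_{0\le i<n}v_{x_ix_{i+1}}$, the max being over all paths $x_0x_1\dots x_n$ ($n\ge1$, consecutive elements distinct) with $x_0=x$, $x_n=y$. Put $m^\nu_{xy}=v^*_{xy}-v^*_{yx}$, $\nu=\{xy\in\Pi: m^\nu_{xy}>0\}$,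 $\hat\nu=\{xy\in\Pi: m^\nu_{xy}\ge0\}$. An admissible order is a (strict) total order $\xi\subseteq\Pi$ with $\nu\subseteq\xi\subseteq\hat\nu$; one always exists. Write $x\succ y$ for $xy\in\xi$, $x\succeq y$ for $x\succ y$ or $x=y$, and $x'$ for the immediate successor of $x$ in $\xi$ (for $x$ not last). Given an admissible order $\xi$, the projected scores are obtained as follows. (i) For $x\succ y$: $m^\sigma_{xy}=\min\{m^\nu_{pq}: p\succeq x,\ y\succeq q\}$. (ii) $(t^\sigma_{xy})_{xy\in\Pi}$ is the unique minimizer of $\sum_{xy\in\Pi}(\tau_{xy}-t_{xy})^2$ among all real families $(\tau_{xy})_{xy\in\Pi}$ such that $\tau_{xy}=\tau_{yx}$ for all $xy$; $m^\sigma_{xx'}\le\tau_{xx'}\le1$ for all non-last $x$; $0\le\tau_{xy}-\tau_{xy'}\le m^\sigma_{yy'}$ for all non-last $y$ and all $x\notin\{y,y'\}$. (iii) $\gamma_{xx'}=[(t^\sigma_{xx'}-m^\sigma_{xx'})/2,\ (t^\sigma_{xx'}+m^\sigma_{xx'})/2]$, and for $x\succ y$, $\gamma_{xy}=\bigcup\{\gamma_{pp'}: x\succeq p\succ y\}$, which is a closed interval. (iv) For $x\succ y$: $v^\pi_{xy}=\max\gamma_{xy}$, $v^\pi_{yx}=\min\gamma_{xy}$. The projected scores do not depend on the choice of $\xi$. Rank-like rates: $r_x=N-\sum_{y\ne x}v^\pi_{xy}$ (so $r_x=1$ if $A=\{x\}$). For $\tilde v$ the same procedure is applied with $A$ replaced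 by $\tilde A$ and $N$ by $|\tilde A|$. *)

(* Defs.v *)
From HB Require Import structures.
From mathcomp Require Import all_boot all_order all_algebra.
From mathcomp Require Import all_classical all_reals.

Set Implicit Arguments.
Unset Strict Implicit.
Unset Printing Implicit Defensive.
Import Order.TTheory GRing.Theory Num.Theory.
Local Open Scope ring_scope.

(* A family indexed by the ordered pairs xy with x != y is represented by a
   function A -> A -> R; its values on the diagonal are never used. *)

Section Scores.
Variables (R : realType) (A : finType).
Implicit Types (v t : A -> A -> R) (xi rho : rel A) (C : {set A}).

Definition llull v : Prop :=
  forall x y, x != y -> 0 <= v x y <= 1 /\ v x y + v y x <= 1.

Definition collective (K : finType) (alpha : K -> R) (w : K -> A -> A -> R) :
    A -> A -> R :=
  fun x y => \sum_k alpha k * w k x y.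

Definition cluster v C : Prop :=
  forall a b x, a \in C -> b \in C -> x \notin C ->
    v a x = v b x /\ v x a = v x b.

Definition turnover v (x y : A) : R := v x y + v y x.

(* x :: p is a path x_0 x_1 ... x_n from x to y, with n = size p >= 1. *)
Definition links_to (x y : A) (p : seq A) : bool :=
  [&& path (fun a b => a != b) x p, p != [::] & last x p == y].

(* pairmap v x p lists the scores v x_i x_{i+1}; the default value of the
   minimum is the first of them, hence this is a true minimum when p != [::]. *)
Definition path_score v (x : A) (p : seq A) : R :=
  let s := pairmap v x p in \big[Num.min/head 0 s]_(a <- s) a.

(* There are infinitely many paths, but their scores form a finite set, which
   is nonempty for x != y; so this supremum is a maximum. *)
Definition indirect v (x y : A) : R :=
  sup [set path_score v x p | p in [set p | links_to x y p]]%classic.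

Definition mnu v (x y : A) : R := indirect v x y - indirect v y x.

Definition strict_total_order xi : Prop :=
  [/\ irreflexive xi, transitive xi & forall x y, x != y -> xi x y || xi y x].

Definition admissible v xi : Prop :=
  [/\ strict_total_order xi,
      forall x y, x != y -> 0 < mnu v x y -> xi x y
    & forall x y, xi x y -> 0 <= mnu v x y].

Definition succeq xi : rel A := fun x y => (x == y) || xi x y.

(* x' is the immediate successor of x. *)
Definition next_in xi : rel A :=
  fun x x' => xi x x' && ~~ [exists z, xi x z && xi z x'].

(* To be used for xi x y; the pair (x, y), which provides the default value of
   the minimum, is among those considered. *)
Definition msigma v xi (x y : A) : R :=
  \big[Num.min/mnu v x y]_(pq : A * A | succeq xi pq.1 x && succeq xi y pq.2)
     mnu v pq.1 pq.2.

Definition turnover_feasible v xi t : Prop :=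
  [/\ forall x y, x != y -> t x y = t y x,
      forall x x', next_in xi x x' -> msigma v xi x x' <= t x x' <= 1
    & forall x y y', next_in xi y y' -> x != y -> x != y' ->
        0 <= t x y - t x y' <= msigma v xi y y'].

Definition turnover_cost v t : R :=
  \sum_(xy : A * A | xy.1 != xy.2) (t xy.1 xy.2 - turnover v xy.1 xy.2) ^+ 2.

(* t is t^sigma; off the diagonal it is unique. *)
Definition projected_turnover v xi t : Prop :=
  turnover_feasible v xi t /\
  forall tau, turnover_feasible v xi tau -> turnover_cost v t <= turnover_cost v tau.

Definition gamma_link v xi t (x x' : A) : set R :=
  `[(t x x' - msigma v xi x x') / 2, (t x x' + msigma v xi x x') / 2]%classic.

Definition gamma v xi t (x y : A) : set R :=
  [set s | exists p p', [/\ succeq xi x p, xi p y, next_in xi p p' &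
                            gamma_link v xi t p p' s]]%classic.

(* gamma x y is a nonempty closed bounded interval for xi x y: sup and inf are
   its maximum and minimum. *)
Definition projected_score v xi t (x y : A) : R :=
  if xi x y then sup (gamma v xi t x y) else inf (gamma v xi t y x).

(* r is the family of rank-like rates determined by v. *)
Definition rank_like_rates v (r : A -> R) : Prop :=
  exists xi t,
    [/\ admissible v xi, projected_turnover v xi t &
        forall x, r x = #|A|%:R - \sum_(y | y != x) projected_score v xi t x y].

Definition ranking (r : A -> R) : rel A := fun x y => (x != y) && (r x < r y).

End Scores.

(* (A \ C) with a new element, None, added. *)
Definition contracted (A : finType) (C : {set A}) : finType :=
  option {x : A | x \notin C}.

Definition contract_rel (A : finType) (C : {set A}) (rho : rel A) :
    rel (contracted C) :=
  fun p q =>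
    match p, q with
    | Some x, Some y => rho (val x) (val y)
    | Some x, None => [exists c in C, rho (val x) c]
    | None, Some y => [exists c in C, rho c (val y)]
    | None, None => false
    end.

Definition contract_scores (R : realType) (A : finType) (C : {set A}) (c : A)
    (v : A -> A -> R) : contracted C -> contracted C -> R :=
  fun p q => v (oapp val c p) (oapp val c q).

Arguments contract_rel {A} C rho p q.
Arguments contract_scores {R A} C c v p q.

(* Main.v *)
(** The strict ranking can be read off the margins [mnu] alone.  Along an
    admissible order, a link xx' with [msigma x x' = 0] forces [t z x = t z x']
    for every other z, hence equal projected scores and equal rates; a link with
    [msigma x x' > 0] forces [r x < r x'], and means that every element up to x
    has a positive margin over every element from x' on.  So [r x < r y] iff x
    and y are separated by a dominant set: one whose elements have positive
    margins over all the others.  The contraction map preserves the margins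
    between elements with distinct images, because the paths whose scores are at
    least s can be both projected and lifted; dominant sets can then be
    transported in both directions. *)
Require Import Defs.
From mathcomp Require Import all_boot all_order all_algebra.
From mathcomp Require Import all_classical all_reals.
From mathcomp Require Import lra.
Set Implicit Arguments.
Unset Strict Implicit.
Unset Printing Implicit Defensive.
Import Order.TTheory GRing.Theory Num.Theory.
Local Open Scope ring_scope.

(** * Finite strict total orders and induction along immediate successors *)

Section Linear_order.
Variables (A : finType) (xi : rel A).
Hypothesis xi_total : strict_total_order xi.

Lemma xi_irr x : xi x x = false.
Proof. by case: xi_total. Qed.

Lemma xi_trans y x z : xi x y -> xi y z -> xi x z.
Proof. by case: xi_total => _ tr _; apply: tr. Qed.

Lemma xi_neq x y : xi x y -> x != y.
Proof. by apply: contraTneq => ->; rewrite xi_irr. Qed.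

Lemma xi_asym x y : xi x y -> ~~ xi y x.
Proof. by move=> xy; apply/negP => /(xi_trans xy); rewrite xi_irr. Qed.

Lemma succeq_refl x : succeq xi x x.
Proof. by rewrite /succeq eqxx. Qed.

Lemma succeqW x y : xi x y -> succeq xi x y.
Proof. by rewrite /succeq => ->; rewrite orbT. Qed.

Lemma succeq_xi_trans y x z : succeq xi x y -> xi y z -> xi x z.
Proof. by case/orP => [/eqP-> //|xy yz]; apply: xi_trans yz. Qed.

Lemma xi_succeq_trans y x z : xi x y -> succeq xi y z -> xi x z.
Proof. by move=> xy /orP[/eqP<- //|]; apply: xi_trans. Qed.

Lemma succeqNgt x y : succeq xi x y = ~~ xi y x.
Proof.
apply/idP/idP => [xy|].
  by apply/negP => /(succeq_xi_trans xy); rewrite xi_irr.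
rewrite /succeq; case: eqVneq => //= xy.
by case: xi_total => _ _ /(_ x y xy) /orP[-> //| ->].
Qed.

Lemma next_xi x x' : next_in xi x x' -> xi x x'.
Proof. by case/andP. Qed.

Lemma next_succeq x x' z : next_in xi x x' -> xi x z -> succeq xi x' z.
Proof.
case/andP=> _ /existsPn/(_ z); rewrite succeqNgt => + xz.
by rewrite xz.
Qed.

Lemma next_succeqV x x' z : next_in xi x x' -> xi z x' -> succeq xi z x.
Proof.
case/andP=> _ /existsPn/(_ z); rewrite succeqNgt => + zx'.
by rewrite zx' andbT.
Qed.

(** Induction on the number of elements strictly between [x] and [y]: an intermediate [z] leaves two
    shorter intervals, neither containing [z]. *)
Lemma next_exists x y : xi x y ->
  (exists2 x', next_in xi x x' & succeq xi x' y) /\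
  (exists2 p, next_in xi p y & succeq xi x p).
Proof.
move: {2}#|_|.+1 (ltnSn #|[set z | xi x z && xi z y]|) => n.
elim: n x y => // n IHn x y le_n xy.
case next_xy: (next_in xi x y).
  by split; [exists y | exists x]; rewrite ?succeq_refl.
move: next_xy; rewrite /next_in xy /= => /negbFE/existsP[z /andP[xz zy]].
have smaller (B : {set A}) : z \notin B ->
    B \subset [set t | xi x t && xi t y] -> (#|B| < n)%N.
  move=> zB sB; apply: leq_trans (le_n : (_ <= n)%N); apply: proper_card.
  by apply/properP; split=> //; exists z; rewrite ?inE ?xz ?zy.
have lt_xz : (#|[set t | xi x t && xi t z]| < n)%N.
  apply: smaller; first by rewrite inE xi_irr andbF.
  apply/fintype.subsetP => t; rewrite !inE => /andP[-> tz].
  exact: xi_trans tz zy.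
have lt_zy : (#|[set t | xi z t && xi t y]| < n)%N.
  apply: smaller; first by rewrite inE xi_irr.
  apply/fintype.subsetP => t; rewrite !inE => /andP[zt ->].
  by rewrite (xi_trans xz zt).
have [[x' nx' x'z] _] := IHn x z lt_xz xz.
have [_ [p np zp]] := IHn z y lt_zy zy.
split; [exists x' => // | exists p => //]; apply: succeqW.
  exact: succeq_xi_trans zy.
exact: xi_succeq_trans zp.
Qed.

Lemma next_ind (Q : A -> A -> Prop) :
    (forall x, Q x x) ->
    (forall x x' y, next_in xi x x' -> succeq xi x' y -> Q x' y -> Q x y) ->
  forall x y, succeq xi x y -> Q x y.
Proof.
move=> Q0 QS x y.
move: {2}#|_|.+1 (ltnSn #|[set z | xi x z]|) => n.
elim: n x => // n IHn x le_n /orP[/eqP-> //|xy].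
have [[x' nx' x'y] _] := next_exists xy.
apply: (QS _ _ _ nx' x'y); apply: IHn => //.
apply: leq_trans (le_n : (_ <= n)%N); apply: proper_card.
apply/properP; split; last first.
  by exists x'; rewrite inE ?xi_irr //; apply: next_xi.
apply/fintype.subsetP => t; rewrite !inE; exact: xi_trans (next_xi nx').
Qed.

End Linear_order.

Definition dominant (R : realType) (A : finType) (v : A -> A -> R)
    (S : {set A}) : Prop :=
  forall a b, a \in S -> b \notin S -> 0 < mnu v a b.

(** * Projected scores and rates along an admissible order *)

Section Rates.
Variables (R : realType) (A : finType) (v t : A -> A -> R) (xi : rel A).
Hypothesis xi_adm : admissible v xi.
Hypothesis t_feas : turnover_feasible v xi t.

Let xi_total : strict_total_order xi. Proof. by case: xi_adm. Qed.

Local Notation m := (msigma v xi).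
Local Notation vp := (projected_score v xi t).

Lemma msigma_ge0 x y : xi x y -> 0 <= m x y.
Proof.
move=> xy; case: xi_adm => _ _ mge0.
apply: le_bigmin => [|[p q] /= /andP[px yq]]; apply: mge0 => //.
exact: (succeq_xi_trans xi_total) px (xi_succeq_trans xi_total xy yq).
Qed.

(** When [y] is the successor of [x], the condition on the right makes the elements up to [x] a
    dominant set. *)
Lemma msigma_gt0P x y : xi x y ->
  reflect (forall p q, succeq xi p x -> succeq xi y q -> 0 < mnu v p q)
          (0 < m x y).
Proof.
move=> xy; apply: (iffP idP) => [m0 p q px yq|m0].
  apply: lt_le_trans m0 _.
  by rewrite (bigmin_le_cond _ _ (j := (p, q))) //= px.
apply: lt_bigmin => [|[p q] /= /andP[]]; last exact: m0.
by apply: m0; rewrite succeq_refl.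
Qed.

Lemma gamma_linkP x x' s :
  gamma_link v xi t x x' s <->
  (t x x' - m x x') / 2 <= s <= (t x x' + m x x') / 2.
Proof. by rewrite /gamma_link set_itvE. Qed.

Lemma gamma_link_gamma p p' x y s : next_in xi p p' ->
    succeq xi x p -> xi p y -> gamma_link v xi t p p' s ->
  gamma v xi t x y s.
Proof. by move=> *; exists p, p'. Qed.

Lemma gamma_sub x x1 y y1 : succeq xi x x1 -> succeq xi y1 y ->
  (gamma v xi t x1 y1 `<=` gamma v xi t x y)%classic.
Proof.
move=> xx1 y1y s [p [p' [x1p py1 npp' sp]]]; exists p, p'; split=> //.
  case/orP: x1p => [/eqP<- //|x1p].
  by apply: succeqW; apply: (succeq_xi_trans xi_total) xx1 x1p.
exact: (xi_succeq_trans xi_total) py1 y1y.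
Qed.

(** On each link, feasibility gives [m <= t <= 1], so [(t - m) / 2 >= 0] and
    [(t + m) / 2 <= t <= 1]. *)
Lemma gamma_itv01 x y s : gamma v xi t x y s -> 0 <= s <= 1.
Proof.
case=> p [p' [_ _ npp' /gamma_linkP]].
case: t_feas => _ /(_ _ _ npp') tpp' _; lra.
Qed.

Lemma gamma_nonempty x y : xi x y -> (gamma v xi t x y !=set0)%classic.
Proof.
move=> xy; have [[x' nxx' _] _] := next_exists xi_total xy.
exists (t x x' / 2); apply: (gamma_link_gamma nxx') => //.
  exact: succeq_refl.
apply/gamma_linkP; have := msigma_ge0 (next_xi nxx'); lra.
Qed.

Lemma gamma_has_sup x y : xi x y -> has_sup (gamma v xi t x y).
Proof.
move=> xy; split; first exact: gamma_nonempty.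
by exists 1 => s /gamma_itv01/andP[].
Qed.

Lemma gamma_has_inf x y : xi x y -> has_inf (gamma v xi t x y).
Proof.
move=> xy; split; first exact: gamma_nonempty.
by exists 0 => s /gamma_itv01/andP[].
Qed.

Lemma projected_score_gt x y : xi x y -> vp x y = sup (gamma v xi t x y).
Proof. by rewrite /projected_score => ->. Qed.

Lemma projected_score_lt x y : xi x y -> vp y x = inf (gamma v xi t x y).
Proof.
by move=> xy; rewrite /projected_score (negbTE (xi_asym xi_total xy)).
Qed.

Lemma next_sep x x' z : next_in xi x x' -> z != x -> z != x' ->
  (xi z x /\ xi z x') \/ (xi x z /\ xi x' z).
Proof.
move=> nxx' zx zx'; case: xi_total => _ _ /(_ z x zx) /orP[zx0|xz].
  by left; split=> //; apply: (xi_trans xi_total) zx0 (next_xi nxx').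
right; split=> //.
by move: (next_succeq xi_total nxx' xz); rewrite /succeq eq_sym (negbTE zx').
Qed.

(** If [z] precedes both, [gamma z x] is included in [gamma z x'] and infima are compared; otherwise
    [gamma x' z] is included in [gamma x z] and suprema are compared. *)
Lemma projected_score_next x x' z : next_in xi x x' -> z != x -> z != x' ->
  vp x' z <= vp x z.
Proof.
move=> nxx' zx zx'; have xx' := succeqW (next_xi nxx').
have [[zx0 zx'0]|[xz x'z]] := next_sep nxx' zx zx'.
  rewrite !projected_score_lt //.
  apply: lb_le_inf; first exact: gamma_nonempty.
  move=> s /(gamma_sub (succeq_refl xi z) xx') zs.
  by apply: ge_inf zs; case: (gamma_has_inf zx'0).
rewrite !projected_score_gt //.
apply: ge_sup; first exact: gamma_nonempty.
move=> s /(gamma_sub xx' (succeq_refl xi z)) zs.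
by apply: ub_le_sup zs; case: (gamma_has_sup xz).
Qed.

(** The interval of the link itself, of length [m x x'], lies in [gamma x x']. *)
Lemma projected_score_link x x' : next_in xi x x' ->
  vp x' x + m x x' <= vp x x'.
Proof.
move=> nxx'; have xx' := next_xi nxx'; have m0 := msigma_ge0 xx'.
rewrite projected_score_lt // projected_score_gt //.
have link s := @gamma_link_gamma x x' x x' s nxx' (succeq_refl xi x) xx'.
have [_ ub] := gamma_has_sup xx'; have [_ lb] := gamma_has_inf xx'.
have hi : (t x x' + m x x') / 2 <= sup (gamma v xi t x x').
  by apply: ub_le_sup => //; apply: link; apply/gamma_linkP; lra.
have lo : inf (gamma v xi t x x') <= (t x x' - m x x') / 2.
  by apply: ge_inf => //; apply: link; apply/gamma_linkP; lra.
lra.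
Qed.

(* When [m x x' = 0] the interval of the link xx' is a point; feasibility
   places it inside the intervals of the two neighbouring links. *)
Lemma projected_score_tie x x' z : next_in xi x x' -> m x x' = 0 ->
  z != x -> z != x' -> vp x z = vp x' z.
Proof.
move=> nxx' m0 zx zx'; have xx' := next_xi nxx'.
case: t_feas => tC _ tmono.
have tE y : y != x -> y != x' -> t y x = t y x'.
  by move=> yx yx'; have := tmono y x x' nxx' yx yx'; rewrite m0; lra.
have [[zx0 zx'0]|[xz x'z]] := next_sep nxx' zx zx'.
  rewrite !projected_score_lt //; congr inf; apply/seteqP; split.
    exact: gamma_sub (succeq_refl xi z) (succeqW xx').
  move=> s [p [p' [zp px' npp' sp]]].
  have /orP[/eqP px|px] := next_succeqV xi_total nxx' px'; last first.
    exact: (gamma_link_gamma npp').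
  subst p; have /orP[/eqP x'p|] := next_succeq xi_total nxx' (next_xi npp').
    (* The only new link is xx'. With [p] the predecessor of [x], feasibility and [t p x = t p x']
       give [0 <= t p x - t x x' <= m p x], so the point [t x x' / 2] already lies in the interval
       of px. *)
    subst p'; have [_ [p npx zp1]] := next_exists xi_total zx0.
    apply: (gamma_link_gamma npx) => //; first exact: next_xi npx.
    have px : p != x := xi_neq xi_total (next_xi npx).
    have px'' : p != x'.
      exact: (xi_neq xi_total (xi_trans xi_total (next_xi npx) xx')).
    move/gamma_linkP: sp; rewrite m0 => sp; apply/gamma_linkP.
    have := tmono x' p x npx.
    rewrite (tC x' p) 1?eq_sym // (tC x' x) 1?eq_sym ?(xi_neq xi_total xx') //.
    rewrite -tE // eq_sym px'' eq_sym (xi_neq xi_total xx') => /(_ isT isT).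
    by have := msigma_ge0 (next_xi npx); lra.
  move=> x'p'; case/andP: npp' => _ /existsPn/(_ x').
  by rewrite xx' x'p'.
rewrite !projected_score_gt //; congr sup; apply/seteqP; split; last first.
  exact: gamma_sub (succeqW xx') (succeq_refl xi z).
move=> s [p [p' [/orP[/eqP xp|xp] pz npp' sp]]]; last first.
  apply: (gamma_link_gamma npp') => //.
  exact: (next_succeq xi_total nxx').
subst p; have /orP[/eqP x'p|] := next_succeq xi_total nxx' (next_xi npp').
  (* Here the successor [q] of [x'] serves: [0 <= t x x' - t x' q <= m x' q]. *)
  subst p'; have [[q nxq qz] _] := next_exists xi_total x'z.
  apply: (gamma_link_gamma nxq) => //; first exact: succeq_refl.
  have qx' : x' != q := xi_neq xi_total (next_xi nxq).
  have qx : x != q := xi_neq xi_total (xi_trans xi_total xx' (next_xi nxq)).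
  move/gamma_linkP: sp; rewrite m0 => sp; apply/gamma_linkP.
  have := tmono x x' q nxq (xi_neq xi_total xx') qx.
  rewrite (tC x q) // tE 1?eq_sym // (tC q x') 1?eq_sym //.
  by have := msigma_ge0 (next_xi nxq); lra.
move=> x'p'; case/andP: npp' => _ /existsPn/(_ x').
by rewrite xx' x'p'.
Qed.

Variable r : A -> R.
Hypothesis rE : forall x, r x = #|A|%:R - \sum_(y | y != x) vp x y.

Lemma rate_next x x' : x != x' ->
  r x' - r x = vp x x' - vp x' x +
    \sum_(y | (y != x) && (y != x')) (vp x y - vp x' y).
Proof.
move=> xx'; rewrite !rE.
have -> : \sum_(y | y != x) vp x y =
    vp x x' + \sum_(y | (y != x) && (y != x')) vp x y.
  by rewrite (bigD1 x') // eq_sym.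
have -> : \sum_(y | y != x') vp x' y =
    vp x' x + \sum_(y | (y != x) && (y != x')) vp x' y.
  by rewrite (bigD1 x) //=; congr (_ + _); apply: eq_bigl => y; rewrite andbC.
by rewrite sumrB; lra.
Qed.

Lemma rate_next_ge x x' : next_in xi x x' -> r x + m x x' <= r x'.
Proof.
move=> nxx'; have := rate_next (xi_neq xi_total (next_xi nxx')).
have := projected_score_link nxx'.
have : 0 <= \sum_(y | (y != x) && (y != x')) (vp x y - vp x' y).
  by apply: sumr_ge0 => y /andP[yx yx']; rewrite subr_ge0 projected_score_next.
lra.
Qed.

(** The scores against third elements cancel, and [gamma x x'] is a single point, so the two scores
    between [x] and [x'] agree as well. *)
Lemma rate_next_tie x x' : next_in xi x x' -> m x x' = 0 -> r x = r x'.
Proof.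
move=> nxx' m0; have xx' := next_xi nxx'.
apply/esym/eqP; rewrite -subr_eq0 rate_next ?(xi_neq xi_total) //.
rewrite big1 => [|y /andP[yx yx']]; last first.
  by rewrite (projected_score_tie nxx') ?subrr.
rewrite addr0 projected_score_gt // projected_score_lt //.
have -> : gamma v xi t x x' = [set t x x' / 2]%classic.
  apply/seteqP; split=> s /=.
    case=> p [p' [xp px' npp']].
    have /orP[/eqP px|px] := next_succeqV xi_total nxx' px'; last first.
      by move: xp; rewrite (succeqNgt xi_total) px.
    subst p; have /orP[/eqP x'p|] := next_succeq xi_total nxx' (next_xi npp').
      by subst p' => /gamma_linkP; rewrite m0; lra.
    move=> x'p'; case/andP: npp' => _ /existsPn/(_ x').
    by rewrite xx' x'p'.
  move=> ->; apply: (gamma_link_gamma nxx') => //; first exact: succeq_refl.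
  by apply/gamma_linkP; rewrite m0; lra.
by rewrite sup1 inf1 subrr.
Qed.

Lemma rate_mono x y : succeq xi x y -> r x <= r y.
Proof.
move: x y; apply: (next_ind xi_total) => // x x' y nxx' _.
apply: le_trans; apply: le_trans (rate_next_ge nxx').
by rewrite lerDl msigma_ge0 // next_xi.
Qed.

(** Walking from [x] to [y], the first link with positive [m] provides the dominant set, namely the
    initial segment ending there. Conversely, a dominant set is an initial segment of [xi], and the
    link that leaves it has positive [m]. *)
Lemma rate_ltP x y :
  r x < r y <-> exists S : {set A}, [/\ x \in S, y \notin S & dominant v S].
Proof.
split=> [rxy|[S [xS yS domS]]].
  have xy : succeq xi x y.
    rewrite (succeqNgt xi_total); apply/negP => /succeqW/rate_mono.
    by rewrite leNgt rxy.
  move: x y xy rxy; apply: (next_ind xi_total) => [x|x x' y nxx' x'y IH rxy].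
    by rewrite ltxx.
  have xx' := next_xi nxx'.
  have := msigma_ge0 xx'; rewrite le_eqVlt => /orP[/eqP/esym m0|m0].
    rewrite (rate_next_tie nxx' m0) in rxy.
    have [S [x'S yS domS]] := IH rxy; exists S; split=> //.
    (* Were [x] outside [S], the margin of [x'] over [x] would be positive and [x'] would precede
       [x]. *)
    apply/negPn/negP => xS; have := domS _ _ x'S xS.
    case: xi_adm => _ nuxi _ /nuxi; rewrite eq_sym (xi_neq xi_total xx').
    by move/(_ isT) => /(xi_asym xi_total); rewrite xx'.
  exists [set p | succeq xi p x]; rewrite !inE succeq_refl; split=> //.
    rewrite (succeqNgt xi_total) negbK.
    exact: (xi_succeq_trans xi_total) xx' x'y.
  move=> a b; rewrite !inE => ax; rewrite (succeqNgt xi_total) negbK => xb.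
  have /msigma_gt0P := m0; apply=> //.
  exact: (next_succeq xi_total) nxx' xb.
have domxi a b : a \in S -> b \notin S -> xi a b.
  move=> aS bS; case: xi_adm => _ nuxi _; apply: nuxi (domS _ _ aS bS).
  by apply: contraNneq bS => <-.
have xy := succeqW (domxi _ _ xS yS).
move: x y xy xS yS.
apply: (next_ind xi_total) => [x ->//|x x' y nxx' x'y IH xS yS].
have xx' := next_xi nxx'.
have [x'S|x'S] := boolP (x' \in S).
  apply: le_lt_trans (IH x'S yS); apply: rate_mono; exact: succeqW.
apply: lt_le_trans (rate_mono x'y).
apply: lt_le_trans (rate_next_ge nxx'); rewrite ltrDl.
(* The link xx' leaves [S], so everything up to [x] is in [S] and everything from [x'] on is
   outside. *)
apply/msigma_gt0P => // p q px x'q; apply: domS.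
  apply: contraTT px => pS; rewrite (succeqNgt xi_total) negbK.
  exact: domxi.
apply: contraTN x'q => qS; rewrite (succeqNgt xi_total) negbK.
exact: domxi.
Qed.

End Rates.

(** The criterion mentions neither the order nor the turnovers, so rates on two different sets can
    be compared through dominant sets alone. *)
Lemma rank_like_rates_ltP (R : realType) (A : finType) (v : A -> A -> R)
    (r : A -> R) (x y : A) : rank_like_rates v r ->
  r x < r y <-> exists S : {set A}, [/\ x \in S, y \notin S & dominant v S].
Proof. by case=> xi [t [adm [feas _] rE]]; apply: (rate_ltP adm feas rE). Qed.

(** * Indirect scores as connectivity in threshold graphs *)

Section Indirect.
Variables (R : realType) (A : finType) (v : A -> A -> R).

Definition link_ge (s : R) : rel A := fun a b => (a != b) && (s <= v a b).

Lemma le_path_score s x p : p != [::] ->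
  (s <= path_score v x p) = all (>= s) (pairmap v x p).
Proof.
case: p => // a p _; rewrite /path_score [pairmap _ _ _]/=.
move: (v x a) (pairmap v a p) => d l; rewrite [head _ _]/=.
apply/idP/allP => [le_s b bl|le_s].
  (* The default value is detached from the head of the list so that the induction goes through. *)
  apply: le_trans le_s _; move: (d :: l) {2}d bl => {d l}; elim=> // h l IHl d.
  by rewrite big_cons inE ge_min => /orP[/eqP->|/IHl->]; rewrite ?lexx ?orbT.
by rewrite big_seq; apply: le_bigmin => //; apply: le_s; rewrite mem_head.
Qed.

(** The empty sequence, excluded by [links_to] but accepted by [path], cannot end at [y] because
    [x != y]. *)
Lemma links_to_path s x y p : x != y ->
  links_to x y p && (s <= path_score v x p) =
  path (link_ge s) x p && (last x p == y).
Proof.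
move=> xy; have -> : path (link_ge s) x p =
    path (fun a b => a != b) x p && all (>= s) (pairmap v x p).
  elim: p x {xy} => //= a p IHp x; rewrite IHp /link_ge.
  by case: (x != a); case: (s <= v x a) => //=; rewrite ?andbF.
rewrite /links_to; have [->|p0] := eqVneq p [::].
  by rewrite /= (negbTE xy).
rewrite le_path_score //=.
by rewrite -!andbA; congr (_ && _); rewrite andbC.
Qed.

Lemma indirect_scores_ne x y : x != y ->
  ([set path_score v x p | p in [set p | links_to x y p]] !=set0)%classic.
Proof.
move=> xy; exists (path_score v x [:: y]), [:: y] => //=.
by rewrite /links_to /= xy eqxx.
Qed.

Lemma indirect_scores_has_sup x y : x != y ->
  has_sup [set path_score v x p | p in [set p | links_to x y p]]%classic.
Proof.
move=> xy; split; first exact: indirect_scores_ne.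
(* A path scores at most its first link, which is one term of this sum up to absolute value. *)
exists (\sum_(ab : A * A) `|v ab.1 ab.2|) => _ [p /= xp <-].
have := links_to_path (path_score v x p) p xy; rewrite xp lexx /=.
case: p {xp} => [|a p] /=; first by rewrite (negbTE xy).
move/esym => /andP[/andP[/andP[_ le_v] _] _]; apply: le_trans le_v _.
rewrite (bigD1 (x, a)) //=; apply: le_trans (ler_norm _) _.
by rewrite lerDl sumr_ge0.
Qed.

Lemma connect_link_ge s x y : x != y ->
  connect (link_ge s) x y <->
  exists2 p, links_to x y p & s <= path_score v x p.
Proof.
move=> xy; split=> [/connectP[p xp yE]|[p xp sp]].
  have := links_to_path s p xy; rewrite xp yE eqxx => /andP[? ?].
  by exists p.
have := links_to_path s p xy; rewrite xp sp => /esym/andP[pp /eqP yE].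
by apply/connectP; exists p.
Qed.

End Indirect.

(** Each path score for [v] is itself a level [s], at which the hypothesis yields a path for [v']
    scoring at least as much. *)
Lemma indirect_le (R : realType) (A B : finType) (v : A -> A -> R)
    (v' : B -> B -> R) x y x' y' : x != y -> x' != y' ->
    (forall s, connect (link_ge v s) x y -> connect (link_ge v' s) x' y') ->
  indirect v x y <= indirect v' x' y'.
Proof.
move=> xy xy' vv'; apply: sup_le.
- move=> _ [p xp <-].
  have /vv'/(connect_link_ge _ _ xy')[q x'q le_q] :
      connect (link_ge v (path_score v x p)) x y.
    by apply/connect_link_ge => //; exists p.
  by exists (path_score v' x' q) => //=; split=> //; exists q.
- exact: indirect_scores_ne.
- exact: indirect_scores_has_sup.
Qed.

(** * Surjections that preserve the scores between distinct fibres *)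

Section Fibration.
Variables (R : realType) (A B : finType) (v : A -> A -> R) (v' : B -> B -> R).
Variable f : A -> B.
Hypothesis f_surj : forall b, exists a, f a = b.
Hypothesis vf : forall a b, f a != f b -> v' (f a) (f b) = v a b.

(** To project a path, drop the links inside a fibre; to lift one, choose any preimage of each
    vertex. *)
Lemma connect_fibration s x y : f x != f y ->
  connect (link_ge v s) x y = connect (link_ge v' s) (f x) (f y).
Proof.
move=> fxy; apply/idP/idP => /connectP[p].
  move=> + ->; elim: p x {fxy} => //= a p IHp x /andP[/andP[_ le_s] ap].
  apply: connect_trans (IHp a ap).
  have [->//|fxa] := eqVneq (f x) (f a).
  by apply: connect1; rewrite /link_ge fxa vf.
elim: p x fxy => /= [x /eqP fxy _ /esym //|b p IHp x fxy /andP[xb bp] yE].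
have neq_f a1 a2 : f a1 != f a2 -> a1 != a2 by apply: contraNneq => ->.
(* The lift stops at the first visit to [f y], where [y] itself is chosen as the preimage. *)
have [by_|by_] := eqVneq b (f y).
  apply: connect1; move: xb; rewrite by_ /link_ge neq_f // => /andP[_].
  by rewrite vf.
have [z fz] := f_surj b; subst b.
apply: (connect_trans (y := z)); last exact: IHp.
by apply: connect1; case/andP: xb => fxz; rewrite /link_ge neq_f // vf.
Qed.

Lemma mnu_fibration x y : f x != f y -> mnu v' (f x) (f y) = mnu v x y.
Proof.
have indE a b : f a != f b -> indirect v' (f a) (f b) = indirect v a b.
  move=> fab; have ab : a != b by apply: contraNneq fab => ->.
  by apply/eqP; rewrite eq_le !indirect_le // => s; rewrite connect_fibration.
by move=> fxy; rewrite /mnu !indE // eq_sym.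
Qed.

Lemma dominant_preim (S : {set B}) : dominant v' S -> dominant v (f @^-1: S).
Proof.
move=> domS a b; rewrite !inE => aS bS; rewrite -mnu_fibration ?domS //.
by apply: contraNneq bS => <-.
Qed.

Lemma dominant_image (S : {set A}) : dominant v S -> dominant v' (f @: S).
Proof.
move=> domS b b' /imsetP[a aS ->]; have [a' <-] := f_surj b' => fa'S.
rewrite mnu_fibration ?domS //; first by apply: contraNN fa'S => /imset_f->.
by apply: contraNneq fa'S => <-; rewrite imset_f.
Qed.

(** This set consists of the points whose whole fibre lies in [S], whereas [f @: S] also keeps the
    fibres that [S] splits. *)
Lemma dominant_imageC (S : {set A}) :
  dominant v S -> dominant v' (~: (f @: ~: S)).
Proof.
move=> domS b b'; rewrite !inE negbK; have [a <-] := f_surj b => faS.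
case/imsetP=> a'; rewrite inE => a'S b'E; subst b'.
have aS : a \in S by apply: contraNT faS => aS; rewrite imset_f ?inE.
rewrite mnu_fibration ?domS //.
by apply: contraNneq faS => ->; rewrite imset_f ?inE.
Qed.

End Fibration.

Lemma collective_cluster (R : realType) (A K : finType) (alpha : K -> R)
    (w : K -> A -> A -> R) (C : {set A}) :
  (forall k, cluster (w k) C) -> cluster (collective alpha w) C.
Proof.
move=> wC a b x aC bC xC; rewrite /collective.
by split; apply: eq_bigr => k _; have [e1 e2] := wC k a b x aC bC xC;
  rewrite ?e1 ?e2.
Qed.

(** * The contraction map of a cluster and the two rankings *)

Section Contraction.
Variables (R : realType) (A : finType) (v : A -> A -> R) (C : {set A}) (c : A).
Hypothesis vC : cluster v C.
Hypothesis cC : c \in C.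

Definition contract (a : A) : contracted C := insub a.

Lemma contract_in a : a \in C -> contract a = None.
Proof. by move=> aC; rewrite /contract insubN // negbK. Qed.

Lemma contract_val (x : {x : A | x \notin C}) : contract (val x) = Some x.
Proof. exact: valK. Qed.

Lemma contract_surj p : exists a, contract a = p.
Proof.
case: p => [x|]; first by exists (val x); apply: contract_val.
by exists c; apply: contract_in.
Qed.

(** The cluster property lets [c] be replaced by any other element of [C]; this is the hypothesis
    [vf] for the map [contract]. *)
Lemma contract_scoresE a b : contract a != contract b ->
  contract_scores C c v (contract a) (contract b) = v a b.
Proof.
rewrite /contract_scores /contract.
case: insubP => [a' _ <-|/negPn aC]; case: insubP => [b' _ <-|/negPn bC] //= _.
  by have [_] := vC cC bC (valP a').
by have [] := vC cC aC (valP b').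
Qed.

Lemma contract_eq_out a b : a \notin C -> contract b = contract a -> b = a.
Proof.
rewrite /contract => aC; rewrite (insubT (fun x => x \notin C) aC) /=.
by case: insubP => // b' _ <- [->].
Qed.

Variables (r : A -> R) (r' : contracted C -> R).
Hypothesis r_rates : rank_like_rates v r.
Hypothesis r'_rates : rank_like_rates (contract_scores C c v) r'.

Lemma contracted_rate_lt a b : contract a != contract b ->
  r' (contract a) < r' (contract b) -> r a < r b.
Proof.
move=> fab /(rank_like_rates_ltP _ _ r'_rates)[S [aS bS domS]].
apply/(rank_like_rates_ltP _ _ r_rates).
exists (contract @^-1: S); rewrite !inE; split=> //.
exact: (dominant_preim contract_surj contract_scoresE).
Qed.

(* A dominant set that splits [C] is enlarged or shrunk by [C], whichever keeps
   apart [a] and [b], at most one of which lies in [C]. *)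
Lemma rate_lt_contracted a b : contract a != contract b ->
  r a < r b -> r' (contract a) < r' (contract b).
Proof.
move=> fab /(rank_like_rates_ltP _ _ r_rates)[S [aS bS domS]].
apply/(rank_like_rates_ltP _ _ r'_rates).
(* An element outside [C] is alone in its fibre: this keeps [b] out of the image of [S], or, when
   [b] is in [C], keeps [a] in the shrunk set. *)
have [bC|bC] := boolP (b \in C); last first.
  exists (contract @: S); split; first exact: imset_f.
    apply: contraNN bS => /imsetP[x xS /esym/(contract_eq_out bC) <-] //.
  exact: (dominant_image contract_surj contract_scoresE).
have aC : a \notin C.
  by apply: contraNN fab => aC; rewrite !contract_in.
exists (~: (contract @: ~: S)); rewrite !inE negbK; split.
- apply: contraTN aS => /imsetP[x xS /esym/(contract_eq_out aC) <-].
  by rewrite inE in xS.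
- by rewrite imset_f ?inE.
- exact: (dominant_imageC contract_surj contract_scoresE).
Qed.

Lemma ranking_contract a b : contract a != contract b ->
  ranking r' (contract a) (contract b) = ranking r a b.
Proof.
move=> fab; have ab : a != b by apply: contraNneq fab => ->.
rewrite /ranking fab ab /=.
by apply/idP/idP; [apply: contracted_rate_lt | apply: rate_lt_contracted].
Qed.

Lemma ranking_contract_rel p q :
  ranking r' p q = contract_rel C (ranking r) p q.
Proof.
have [->|pq] := eqVneq p q.
  by rewrite /ranking eqxx; case: q => //= x; rewrite eqxx.
case: p q pq => [x|] [y|] //= pq.
- by move: pq; rewrite -!contract_val => /ranking_contract.
(* The comparison does not depend on the element [d] of [C], so the existential can be tested at
   [c]. *)
- have E d : d \in C -> ranking r' (Some x) None = ranking r (val x) d.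
    by move=> dC; rewrite -contract_val -(contract_in dC) ranking_contract //
      contract_val contract_in.
  rewrite (E c cC); apply/idP/existsP => [xc|[d /andP[dC]]].
    by exists c; rewrite cC.
  by rewrite -(E d dC) (E c cC).
- have E d : d \in C -> ranking r' None (Some y) = ranking r d (val y).
    by move=> dC; rewrite -contract_val -(contract_in dC) ranking_contract //
      contract_val contract_in.
  rewrite (E c cC); apply/idP/existsP => [xc|[d /andP[dC]]].
    by exists c; rewrite cC.
  by rewrite -(E d dC) (E c cC).
Qed.

End Contraction.

Theorem theorem16p7 (R : realType) (A K : finType)
    (alpha : K -> R) (w : K -> A -> A -> R) (C : {set A}) (c : A)
    (r : A -> R) (r' : contracted C -> R)
    (alpha_ge0 : forall k, 0 <= alpha k)
    (alpha_sum : \sum_k alpha k = 1)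
    (w_llull : forall k, llull (w k))
    (w_cluster : forall k, cluster (w k) C)
    (c_in_C : c \in C)
    (r_rates : rank_like_rates (collective alpha w) r)
    (r'_rates : rank_like_rates (contract_scores C c (collective alpha w)) r') :
  forall x y : contracted C,
    ranking r' x y = contract_rel C (ranking r) x y.
Proof.
apply: (ranking_contract_rel _ c_in_C r_rates r'_rates).
exact: collective_cluster.
Qed.
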